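(* Let $k \in \mathbb{Z}^+$ be prime, and let $X$ be a compact Hausdorff space with two commuting $\mathbb{Z}/k\mathbb{Z}$ actions $\alpha$ and $\beta$, where $\alpha$ is free and $\beta$ is not. Let $Y = \mathrm{Fix}(\beta) \neq \varnothing$ be equipped with the restricted action $\gamma = \alpha|_Y$, and suppose there is an $(\alpha,\gamma)$-equivariant continuous function $f: X\to Y$. Then there is no unital, $(\alpha,\widetilde{\alpha})$-equivariant $*$-homomorphism from $C(X)$ to $J(C(X),\beta)$.
   Context: Actions on $X$ are by homeomorphisms, and $\mathrm{Fix}(\beta)$ is the set of points of $X$ fixed by every element of $\mathbb{Z}/k\mathbb{Z}$ under $\beta$. An action on $X$ is free if no nonidentity group element fixes a point. Since $k$ is prime, $\beta$ being non-free means exactly that $\mathrm{Fix}(\beta)\ne\varnothing$. The actions $\alpha,\beta$ on $X$ induce actions on $C(X)$ by composition, denoted by the same letters. Let $A = C(X)$ and $\omega = e^{2\pi i/k}$. The group $\Gamma=\mathbb{Z}/k\mathbb{Z}$ acting through $\beta$ is identified with the Pontryagin dual of the group $\mathbb{Z}/k\mathbb{Z}$ acting through $\alpha$. Crossed product: $A \rtimes_\beta \Gamma$ is generated by $A$ and $\Gamma$, where $\Gamma$ is a group of unitaries implementing $\beta$. Writing $\mu$ for the unitary corresponding to a generator, its elements are uniquely $\sum_{j=0}^{k-1} a_j\mu^j$ with $a_j \in A$. Both $A$ and $C^*(\Gamma)$ are regarded as unital subalgebras. Twisted join: $J(A,\beta) = \{h \in C([0,1], A\rtimes_\beta \Gamma)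 : h(0) \in C^*(\Gamma),\ h(1) \in A\}$. Action $\widetilde{\alpha}$: the action of $\mathbb{Z}/k\mathbb{Z}$ on $J(A,\beta)$ obtained by applying pointwise the action on $A\rtimes_\beta\Gamma$ generated by the automorphism $\sum_j a_j\mu^j \mapsto \sum_j \omega^j\alpha(a_j)\mu^j$, where $\alpha$ also denotes the automorphism generating the action $\alpha$ on $A$. A map $\phi$ is $(\sigma,\tau)$-equivariant if $\phi\circ\sigma_g = \tau_g\circ\phi$ for all group elements $g$. *)

(* Defs.v *)
From HB Require Import structures.
From mathcomp Require Import all_boot all_order all_algebra.
From mathcomp Require Import complex.
From mathcomp Require Import all_classical all_reals all_analysis.

Set Implicit Arguments.
Unset Strict Implicit.
Unset Printing Implicit Defensive.

Import Order.TTheory GRing.Theory Num.Theory.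
Import numFieldNormedType.Exports.

Local Open Scope classical_set_scope.
Local Open Scope ring_scope.
Local Open Scope complex_scope.

(* The usual topology of the complex numbers, as a normed space over itself. *)
HB.instance Definition _ (R : realType) := NormedModule.copy R[i] R[i]^o.

(* 'Z_k is Z/kZ only for k >= 2.  Each [act g] is a homeomorphism, with inverse
   [act (- g)]. *)
Record zk_action (k : nat) (X : topologicalType) := ZkAction {
  act :> 'Z_k -> X -> X;
  act0 : forall x, act 0 x = x;
  actD : forall g h x, act (g + h) x = act g (act h x);
  act_continuous : forall g, continuous (act g) }.

Section actions.
Variables (k : nat) (X : topologicalType).
Implicit Types a b : zk_action k X.

Definition free_action a := forall g x, a g x = x -> g = 0.

Definition commuting a b := forall g h x, a g (b h x) = b h (a g x).

Definition Fix a : set X := [set x | forall g, a g x = x].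

Lemma Fix_stable a b : commuting a b ->
  forall g x, Fix b x -> Fix b (a g x).
Proof. by move=> ab g x bx h; rewrite -ab bx. Qed.

Section restriction.
Variables (a : zk_action k X) (Y : set X).
Hypothesis aY : forall g x, Y x -> Y (a g x).

Let aYP g (y : Y) : a g (set_val y) \in Y.
Proof. by apply/mem_set/aY/set_mem; exact: valP. Qed.

Definition restrict_fun (g : 'Z_k) (y : Y) : Y := SigSub (aYP g y).

Lemma restrict_fun0 y : restrict_fun 0 y = y.
Proof. by apply/val_inj; rewrite /= act0. Qed.

Lemma restrict_funD g h y :
  restrict_fun (g + h) y = restrict_fun g (restrict_fun h y).
Proof. by apply/val_inj; rewrite /= actD. Qed.

Lemma restrict_fun_continuous g : continuous (restrict_fun g).
Proof.
apply: continuous_comp_initial => y.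
apply: (@continuous_comp _ _ _ (set_val : Y -> X) (a g)).
  exact: initial_continuous.
exact: act_continuous.
Qed.

Definition restrict_action : zk_action k Y :=
  ZkAction restrict_fun0 restrict_funD restrict_fun_continuous.
End restriction.

End actions.

Definition equivariant (k : nat) (X Y : topologicalType)
    (a : zk_action k X) (b : zk_action k Y) (f : X -> Y) :=
  forall g x, f (a g x) = b g (f x).

Section Cfun.
Variables (R : realType) (X : topologicalType).

Definition Cfun : Type := continuousType X R[i].

HB.instance Definition _ := Choice.on Cfun.

Definition Cfun_val (f : Cfun) : X -> R[i] := f.
Coercion Cfun_val : Cfun >-> Funclass.

Lemma CfunP (f g : Cfun) : f =1 g -> f = g.
Proof. by move=> fg; apply/continuousEP. Qed.

Definition Cmk (f : X -> R[i]) (cf : continuous f) : Cfun :=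
  mkcts cf : continuousType X R[i].

Implicit Types f g h : Cfun.

Lemma Cfun_cst_subproof (c : R[i]) : continuous (fun _ : X => c).
Proof. by move=> x; exact: cvg_cst. Qed.

Lemma Cfun_add_subproof f g : continuous (fun x => f x + g x).
Proof. by move=> x; apply: continuousD; exact: cts_fun. Qed.

Lemma Cfun_opp_subproof f : continuous (fun x => - f x).
Proof. by move=> x; apply: continuousN; exact: cts_fun. Qed.

Lemma Cfun_mul_subproof f g : continuous (fun x => f x * g x).
Proof. by move=> x; apply: (@continuousM R[i]); exact: cts_fun. Qed.

Lemma Cfun_scale_subproof (c : R[i]) f : continuous (fun x => c * f x).
Proof.
by move=> x; apply: (@continuousM R[i]); [exact: cst_continuous|exact: cts_fun].
Qed.

Lemma Cfun_star_subproof f : continuous (fun x => (f x)^*).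
Proof.
move=> x; apply/(@cvgrPdist_le R[i] R[i]) => e e0.
have /(@cvgrPdist_le R[i] R[i])/(_ e e0) := @cts_fun _ _ f x.
by apply: filterS => y; rewrite -(raddfB (@conjc R)) /= normcJ.
Qed.

Definition Cfun_cst c : Cfun := Cmk (@Cfun_cst_subproof c).
Definition Cfun_add f g : Cfun := Cmk (@Cfun_add_subproof f g).
Definition Cfun_opp f : Cfun := Cmk (@Cfun_opp_subproof f).
Definition Cfun_mul f g : Cfun := Cmk (@Cfun_mul_subproof f g).
Definition Cfun_scale c f : Cfun := Cmk (@Cfun_scale_subproof c f).
Definition Cfun_star f : Cfun := Cmk (@Cfun_star_subproof f).

Let CaddA : associative Cfun_add.
Proof. by move=> f g h; apply: CfunP => x; exact: addrA. Qed.
Let CaddC : commutative Cfun_add.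
Proof. by move=> f g; apply: CfunP => x; exact: addrC. Qed.
Let Cadd0 : left_id (Cfun_cst 0) Cfun_add.
Proof. by move=> f; apply: CfunP => x; exact: add0r. Qed.
Let CaddN : left_inverse (Cfun_cst 0) Cfun_opp Cfun_add.
Proof. by move=> f; apply: CfunP => x; exact: addNr. Qed.

HB.instance Definition _ := GRing.isZmodule.Build Cfun CaddA CaddC Cadd0 CaddN.

Let CmulA : associative Cfun_mul.
Proof. by move=> f g h; apply: CfunP => x; exact: mulrA. Qed.
Let CmulC : commutative Cfun_mul.
Proof. by move=> f g; apply: CfunP => x; exact: mulrC. Qed.
Let Cmul1 : left_id (Cfun_cst 1) Cfun_mul.
Proof. by move=> f; apply: CfunP => x; exact: mul1r. Qed.
Let Cmul1r : right_id (Cfun_cst 1) Cfun_mul.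
Proof. by move=> f; apply: CfunP => x; exact: mulr1. Qed.
Let CmulDl : left_distributive Cfun_mul Cfun_add.
Proof. by move=> f g h; apply: CfunP => x; exact: mulrDl. Qed.
Let CmulDr : right_distributive Cfun_mul Cfun_add.
Proof. by move=> f g h; apply: CfunP => x; exact: mulrDr. Qed.

HB.instance Definition _ :=
  GRing.Zmodule_isPzRing.Build Cfun CmulA Cmul1 Cmul1r CmulDl CmulDr.
HB.instance Definition _ := GRing.PzRing_hasCommutativeMul.Build Cfun CmulC.

Let CscaleA c d f : Cfun_scale c (Cfun_scale d f) = Cfun_scale (c * d) f.
Proof. by apply: CfunP => x; exact: mulrA. Qed.
Let Cscale1 : left_id 1 Cfun_scale.
Proof. by move=> f; apply: CfunP => x; exact: mul1r. Qed.
Let CscaleDr : right_distributive Cfun_scale +%R.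
Proof. by move=> c f g; apply: CfunP => x; exact: mulrDr. Qed.
Let CscaleDl f : {morph Cfun_scale^~ f : c d / c + d}.
Proof. by move=> c d; apply: CfunP => x; exact: mulrDl. Qed.

HB.instance Definition _ :=
  GRing.Zmodule_isLmodule.Build R[i] Cfun CscaleA Cscale1 CscaleDr CscaleDl.

End Cfun.

Arguments Cfun_val : simpl never.

Section induced_action.
Variables (R : realType) (k : nat) (X : topologicalType).
Variable a : zk_action k X.
Implicit Types f : Cfun R X.

Lemma Cact_subproof (g : 'Z_k) f : continuous (fun x => f (a g x)).
Proof.
move=> x; apply: (@continuous_comp _ _ _ (a g) f); first exact: act_continuous.
exact: cts_fun.
Qed.

(* Composition with [a g] is an action because Z/kZ is abelian. *)
Definition Cact (g : 'Z_k) f : Cfun R X := Cmk (@Cact_subproof g f).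

Lemma Cact0 f : Cact 0 f = f.
Proof. by apply: CfunP => x; rewrite /Cfun_val /= /mkcts act0. Qed.

Lemma CactD g h f : Cact (g + h) f = Cact g (Cact h f).
Proof. by apply: CfunP => x; rewrite addrC /Cfun_val /= /mkcts actD. Qed.

Lemma Cact_add g f1 f2 : Cact g (f1 + f2) = Cact g f1 + Cact g f2.
Proof. exact: CfunP. Qed.

Lemma Cact_is0 g : Cact g 0 = 0.
Proof. exact: CfunP. Qed.

Lemma Cact_sum g I (r : seq I) (P : pred I) (F : I -> Cfun R X) :
  Cact g (\sum_(i <- r | P i) F i) = \sum_(i <- r | P i) Cact g (F i).
Proof. exact: (big_morph _ (Cact_add g) (Cact_is0 g)). Qed.

Lemma Cact_mul g f1 f2 : Cact g (f1 * f2) = Cact g f1 * Cact g f2.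
Proof. exact: CfunP. Qed.

Lemma Cact_one g : Cact g 1 = 1.
Proof. exact: CfunP. Qed.

End induced_action.

(* [u : crossed R b] stands for the sum of the [u j] mu^j, j in Z/kZ; it
   multiplies by the rule mu^j f = (b_j f) mu^j.  The carrier does not depend on
   [b], but the ring structure attached to [crossed R b] does. *)
Definition crossed (R : realType) (k : nat) (X : topologicalType)
  (b : zk_action k X) : Type := {ffun 'Z_k -> Cfun R X}.

Section crossed_product.
Variables (R : realType) (k : nat) (X : topologicalType).
Variable b : zk_action k X.

HB.instance Definition _ :=
  GRing.Lmodule.copy (crossed R b) {ffun 'Z_k -> Cfun R X}.

Local Notation crossed := (crossed R b).

Implicit Types u v w : crossed.

Definition crossed_one : crossed := [ffun j => if j == 0 then 1 else 0].

Definition crossed_mul u v : crossed :=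
  [ffun m => \sum_j u j * Cact b j (v (m - j))].

(* (f mu^j)^* = mu^(-j) f^* = b_(-j)(f^* ) mu^(-j) *)
Definition crossed_star u : crossed :=
  [ffun m => Cact b m (Cfun_star (u (- m)))].

Let xmulA : associative crossed_mul.
Proof.
move=> u v w; apply/ffunP => m; rewrite !ffunE.
under eq_bigr => j _ do rewrite ffunE Cact_sum mulr_sumr.
under [RHS]eq_bigr => j _ do rewrite ffunE mulr_suml.
rewrite [RHS]exchange_big /=; apply: eq_bigr => j _.
rewrite [RHS](reindex_inj (addrI j)) /=; apply: eq_bigr => i _.
rewrite Cact_mul -CactD mulrA; congr (_ * Cact b j (v _) * Cact b _ (w _)).
  by rewrite addrC addKr.
by rewrite opprD addrA.
Qed.

Let xmul1 : left_id crossed_one crossed_mul.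
Proof.
move=> u; apply/ffunP => m; rewrite ffunE (bigD1 0) //= ffunE eqxx subr0 Cact0.
rewrite mul1r big1 ?addr0 // => j j0.
by rewrite ffunE (negbTE j0) mul0r.
Qed.

Let xmul1r : right_id crossed_one crossed_mul.
Proof.
move=> u; apply/ffunP => m; rewrite ffunE (bigD1 m) //= ffunE subrr eqxx Cact_one.
rewrite mulr1 big1 ?addr0 // => j jm.
by rewrite ffunE subr_eq0 eq_sym (negbTE jm) Cact_is0 mulr0.
Qed.

Let xmulDl : left_distributive crossed_mul +%R.
Proof.
move=> u v w; apply/ffunP => m; rewrite !ffunE -big_split /=.
by apply: eq_bigr => j _; rewrite ffunE mulrDl.
Qed.

Let xmulDr : right_distributive crossed_mul +%R.
Proof.
move=> u v w; apply/ffunP => m; rewrite !ffunE -big_split /=.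
by apply: eq_bigr => j _; rewrite ffunE Cact_add mulrDr.
Qed.

HB.instance Definition _ :=
  GRing.Zmodule_isPzRing.Build crossed xmulA xmul1 xmul1r xmulDl xmulDr.

(* The subalgebra A of elements f mu^0. *)
Definition crossed_base : set crossed :=
  [set u | exists f : Cfun R X, u = [ffun j => if j == 0 then f else 0]].

(* The subalgebra C*(Gamma) of sums c_0 + ... + c_(k-1) mu^(k-1), c_j scalar. *)
Definition crossed_group : set crossed :=
  [set u | exists c : 'Z_k -> R[i], u = [ffun j => c j *: (1 : Cfun R X)]].

Definition l2norm (xi : 'Z_k -> R[i]) : R :=
  Num.sqrt (\sum_i Normc.normc (xi i) ^+ 2).

(* The regular representation of [crossed] on l^2(Z/kZ) induced by evaluation at
   [x] : f acts by (f xi)(i) = (b_(-i) f)(x) xi(i), and mu by translation,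
   (mu xi)(i) = xi(i - 1). *)
Definition regular_rep (x : X) u (xi : 'Z_k -> R[i]) : 'Z_k -> R[i] :=
  fun i => \sum_j Cact b (- i) (u j) x * xi (i - j).

(* The C*-norm: the direct sum over [x] of these representations is the regular
   representation of the crossed product, which is faithful.  The supremum is
   over a bounded set when [X] is compact. *)
Definition crossed_norm u : R :=
  sup [set l2norm (regular_rep x u xi) |
        x in [set: X] & xi in [set xi : 'Z_k -> R[i] | l2norm xi <= 1]].

End crossed_product.

Section twisted_join.
Variables (R : realType) (k : nat) (X : topologicalType).
Variable b : zk_action k X.

Definition unit_itv : set R := [set t | 0 <= t <= 1].

Definition norm_continuous (h : unit_itv -> crossed R b) :=
  forall t : unit_itv, crossed_norm (h s - h t) @[s --> t] --> (0 : R).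

(* A *-subalgebra of the functions from [0, 1] to the crossed product, with the
   pointwise operations. *)
Definition twisted_join : set (unit_itv -> crossed R b) :=
  [set h | [/\ norm_continuous h,
    forall t : unit_itv, set_val t = 0 -> crossed_group (h t) &
    forall t : unit_itv, set_val t = 1 -> crossed_base (h t)]].

End twisted_join.

Arguments twisted_join R {k X} b _.

Section homomorphisms.
Variables (R : realType) (k : nat) (X : topologicalType).
Variables a b : zk_action k X.

Definition is_unital_star_hom (phi : Cfun R X -> twisted_join R b) :=
  [/\ forall f g, set_val (phi (f + g)) = set_val (phi f) + set_val (phi g),
      forall (c : R[i]) f, set_val (phi (c *: f)) = c *: set_val (phi f),
      forall f g, set_val (phi (f * g)) = set_val (phi f) * set_val (phi g),
      set_val (phi 1) = 1 &
      forall f t, set_val (phi (Cfun_star f)) t =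
                  crossed_star (set_val (phi f) t)].

(* e^(2 i pi / k) *)
Definition omega : R[i] :=
  cos (2 * pi / k%:R) +i* sin (2 * pi / k%:R).

Definition tilde_gen (u : crossed R b) : crossed R b :=
  [ffun j : 'Z_k => omega ^+ j *: Cact a 1 (u j)].

(* The class of g mod k acts as the g-th power of the generator; here g is
   coerced to its representative below k. *)
Definition tilde_act (g : 'Z_k) (u : crossed R b) : crossed R b :=
  iter g tilde_gen u.

Definition tilde_equivariant (phi : Cfun R X -> twisted_join R b) :=
  forall g f t,
    set_val (phi (Cact a g f)) t = tilde_act g (set_val (phi f) t).

End homomorphisms.

(* Main.v *)
Require Import Defs.
From mathcomp Require Import all_boot all_order all_algebra.
From mathcomp Require Import complex.
From mathcomp Require Import ring lra.
From mathcomp Require Import all_classical all_reals all_analysis.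
Import Order.TTheory GRing.Theory Num.Theory.
Import numFieldNormedType.Exports.
Local Open Scope classical_set_scope.
Local Open Scope ring_scope.

(** A unital equivariant homomorphism phi from C(X) to the twisted join would give
a homotopy of self-maps of X. The point f(x) is fixed by beta, so evaluating at
f(x) the coefficients of an element of the crossed product, and adding them up,
is a character of the crossed product. Composing it with phi at time t gives a
character of C(X), that is, evaluation at a point H(x, t) of X. The map H is
continuous because the crossed product norm dominates these characters. At time
0 the coefficients are scalars, so H(x, 0) does not depend on x; at time 1 only
the coefficient of mu^0 is left, on which the action on the join restricts to
alpha, so H(_, 1) is equivariant. Hence X would have an equivariant self-map psi
that is null-homotopic.

A free action of Z/k on a nonempty compact Hausdorff space X has no such
self-map: this is a form of the Borsuk-Ulam theorem
([equivariant_not_nullhomotopic]), and the greater part of the file proves it,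
for any k > 1. The reason is the nilpotence of the class in H^2(X/(Z/k); Z) that
classifies the covering of X/(Z/k) by X.
The proof uses Alexander-Spanier cochains of X: integer functions on finite
sequences of points, looked at only near the diagonal ([locally]). The complex
is augmented, the empty sequence having degree -1. Two facts carry it.

- Homotopic maps induce cohomologous pullbacks of cocycles, so pullback by psi
  makes every local cocycle a local coboundary, in degree 0 too because the
  complex is augmented ([cocycle_nullhomotopic]).

- Let T be the pullback of cochains by the generator of the action,
  D = T - 1 and N = 1 + T + ... + T^(k-1). Then D N = N D = 0 and, the action
  being free, the kernel of each operator is the image of the other in degrees
  at least 0. So an invariant cocycle q of such a degree is N u for some u; then
  N(delta u) = 0, so delta u = D v, and q' = delta v is again an invariant
  cocycle, of degree two more. When u and v are made from a labelling of X by elements of Z/k that is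
  constant on an open set W disjoint from its translates, q' vanishes locally on
  the orbit of W, and wherever q does.

Start from q = delta e, where e is 1 on the empty sequence and 0 elsewhere, and
apply the second construction once for each W in a finite family of open sets
whose orbits cover X: the result vanishes locally everywhere. Now go backwards.
If the pullback of q' by psi^n is delta(N w) locally, then the pullback of v by
psi^n minus N w is a cocycle, hence becomes delta z after one more pullback by
psi; applying D, the pullback of u minus D z is a cocycle, hence becomes
delta z' after another pullback; applying N, the pullback of q by psi^(n+2) is
delta(N z') locally. This is [transfer_of_locally_trivial]. For q = delta e, a
one-term sequence gives 1 = k z'(empty sequence), which is impossible in the
integers. *)

Set Implicit Arguments.
Unset Strict Implicit.
Unset Printing Implicit Defensive.

(** * Cochains on finite sequences of points *)

Section cochains.
Variable X : choiceType.
Implicit Types (q : seq X -> int) (s t : seq X) (V : set X).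

(** The alternating sum over the deletions of one term. The recursion on the
first term turns the identities below into structural inductions. On a one-term
sequence the value is [q [::]], so the complex is augmented. *)
Fixpoint coboundary q s : int :=
  if s is y :: s' then q s' - coboundary (fun t => q (y :: t)) s' else 0.

Definition seq_in V s := forall y, y \in s -> V y.

Lemma seq_in_cons V y s : seq_in V (y :: s) <-> V y /\ seq_in V s.
Proof.
split=> [Vs|[Vy Vs] z].
  by split=> [|z zs]; apply: Vs; rewrite inE ?eqxx ?zs ?orbT.
by rewrite inE => /predU1P[->|/Vs].
Qed.

Lemma seq_in_map V (f : X -> X) s : seq_in (f @^-1` V) s -> seq_in V (map f s).
Proof. by move=> Vs _ /mapP[y /Vs Vy ->]. Qed.

Lemma sub_seq_in V W s : V `<=` W -> seq_in V s -> seq_in W s.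
Proof. by move=> VW Vs y /Vs /VW. Qed.

(** Every term of a coboundary is evaluated on a subsequence, so identities
between cochains that hold near a point pass to their coboundaries. *)
Lemma coboundary_eq_in V q1 q2 s :
  (forall t, seq_in V t -> q1 t = q2 t) -> seq_in V s ->
  coboundary q1 s = coboundary q2 s.
Proof.
elim: s q1 q2 => //= y s IHs q1 q2 q12 /seq_in_cons[Vy Vs].
rewrite q12//; congr (_ - _); apply: IHs => // t Vt.
by apply: q12; apply/seq_in_cons.
Qed.

Lemma coboundary0 s : coboundary (fun=> 0) s = 0.
Proof. by elim: s => //= y s ->; rewrite subr0. Qed.

Lemma coboundaryB q1 q2 s :
  coboundary (fun t => q1 t - q2 t) s = coboundary q1 s - coboundary q2 s.
Proof.
elim: s q1 q2 => /= [|y s IHs] q1 q2; first by rewrite subr0.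
by rewrite IHs; ring.
Qed.

Lemma coboundaryD q1 q2 s :
  coboundary (fun t => q1 t + q2 t) s = coboundary q1 s + coboundary q2 s.
Proof.
elim: s q1 q2 => /= [|y s IHs] q1 q2; first by rewrite addr0.
by rewrite IHs; ring.
Qed.

Lemma coboundary_sum (I : finType) (F : I -> seq X -> int) s :
  coboundary (fun t => \sum_i F i t) s = \sum_i coboundary (F i) s.
Proof.
elim: s F => /= [|y s IHs] F; first by rewrite big1.
by rewrite IHs sumrB.
Qed.

Lemma coboundary_map (f : X -> X) q s :
  coboundary q (map f s) = coboundary (fun t => q (map f t)) s.
Proof. by elim: s q => //= y s IHs q; rewrite IHs. Qed.

Lemma coboundary_coboundary q s : coboundary (coboundary q) s = 0.
Proof.
elim: s q => //= y s IHs q.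
by rewrite coboundaryB IHs subr0 subrr.
Qed.

Section prism.
Variables f0 f1 : X -> X.

(** The i-th term of this alternating sum runs through the images of the first
points of [s] under [f0], up to the i-th, and then, from the i-th on, through
the images under [f1]: the usual decomposition of a prism into simplices. *)
Fixpoint prism q s : int :=
  if s is y :: s' then
    q (f0 y :: f1 y :: map f1 s') - prism (fun t => q (f0 y :: t)) s'
  else 0.

Lemma prismB q1 q2 s :
  prism (fun t => q1 t - q2 t) s = prism q1 s - prism q2 s.
Proof.
elim: s q1 q2 => /= [|y s IHs] q1 q2; first by rewrite subr0.
by rewrite IHs; ring.
Qed.

(** The prism operator evaluates a cochain only on points of the two images of
the sequence; smallness of those images therefore suffices for an identity
satisfied by the cochain locally. *)
Lemma prism_eq0 V q s :
    (forall t, seq_in V t -> q t = 0) ->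
    seq_in (f0 @^-1` V) s -> seq_in (f1 @^-1` V) s ->
  prism q s = 0.
Proof.
elim: s q => //= y s IHs q q0 /seq_in_cons[V0y V0s] /seq_in_cons[V1y V1s].
rewrite q0 ?sub0r; last first.
  by do 2![apply/seq_in_cons; split=> //]; exact: seq_in_map.
by rewrite IHs ?oppr0// => t Vt; apply: q0; apply/seq_in_cons.
Qed.

(** The boundary of a prism: its two ends, up to the prism on the boundary. *)
Lemma coboundary_prism q s :
  coboundary (prism q) s + prism (coboundary q) s = q (map f1 s) - q (map f0 s).
Proof.
elim: s q => [|y s IHs] q /=; first by rewrite addr0 [RHS]subrr.
have := IHs (fun t => q (f0 y :: t)).
rewrite coboundaryB prismB coboundary_map; lra.
Qed.

End prism.
End cochains.

(** * Locality and invariance under homotopy *)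

Section locality.
Variable X : topologicalType.
Implicit Types (P Q : seq X -> Prop) (q : seq X -> int) (s : seq X).

(** The germ of a statement at the diagonal: this is the localization that makes
functions on all finite sequences compute Alexander-Spanier cohomology. *)
Definition locally P :=
  forall x : X, exists2 V : set X, nbhs x V & forall s, seq_in V s -> P s.

Lemma locallyW P : (forall s, P s) -> locally P.
Proof. by move=> Ps x; exists setT => //; exact: filterT. Qed.

Lemma sub_locally P Q : (forall s, P s -> Q s) -> locally P -> locally Q.
Proof. by move=> PQ lP x; have [V xV VP] := lP x; exists V => // s /VP /PQ. Qed.

Lemma locallyI P Q : locally P -> locally Q -> locally (fun s => P s /\ Q s).
Proof.
move=> lP lQ x; have [V xV VP] := lP x; have [W xW WQ] := lQ x.
exists (V `&` W); first exact: filterI.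
by move=> s VWs; split; [apply: VP|apply: WQ] => y /VWs[].
Qed.

Lemma locally_map (f : X -> X) P :
  continuous f -> locally P -> locally (fun s => P (map f s)).
Proof.
move=> cf lP x; have [V xV VP] := lP (f x).
exists (f @^-1` V); first exact: cf.
by move=> s /seq_in_map /VP.
Qed.

Lemma locally_forall (I : finType) (P : I -> seq X -> Prop) :
  (forall i, locally (P i)) -> locally (fun s => forall i, P i s).
Proof.
move=> lP x; have /choice[V xV] : forall i, exists V : set X,
    nbhs x V /\ forall s, seq_in V s -> P i s.
  by move=> i; have [V] := lP i x; exists V.
exists [set y | forall i, V i y].
  by apply: filter_forall => i; have [] := xV i.
by move=> s Vs i; have [_] := xV i; apply=> y /Vs.
Qed.

Section homotopy.
Variables (T : topologicalType) (H : X * T -> X).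
Hypotheses (X_compact : compact [set: X]) (T_connected : connected [set: T]).
Hypothesis H_continuous : continuous H.
Variable q : seq X -> int.
Hypothesis q_cocycle : locally (fun s => coboundary q s = 0).

Let cohomologous (f0 f1 : X -> X) := exists z,
  locally (fun s => q (map f1 s) - q (map f0 s) = coboundary z s).

Let cohomologous_sym f0 f1 : cohomologous f0 f1 -> cohomologous f1 f0.
Proof.
move=> [z lz]; exists (fun s => 0 - z s).
apply: sub_locally lz => s e.
by rewrite coboundaryB coboundary0 -e sub0r opprB.
Qed.

Let cohomologous_trans f1 f0 f2 :
  cohomologous f0 f1 -> cohomologous f1 f2 -> cohomologous f0 f2.
Proof.
move=> [z lz] [w lw]; exists (fun s => z s + w s).
apply: sub_locally (locallyI lz lw) => s [ez ew].
by rewrite coboundaryD -ez -ew; ring.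
Qed.

Let slice t x := H (x, t).

(* For t' near t, the slices at t and t' map all small sequences into one
   common small set, where the prism between them sees only the cocycle
   relation. Compactness makes the range of t' uniform in the point of X. *)
Let cohomologous_near t : \forall t' \near t, cohomologous (slice t) (slice t').
Proof.
suff : \forall t' \near t, locally (fun s => prism (slice t) (slice t')
    (coboundary q) s = 0).
  apply: filterS => t' lt'; exists (prism (slice t) (slice t') q).
  by apply: sub_locally lt' => s e; rewrite -coboundary_prism e addr0.
pose small (t' : T) (x : X) := exists2 W : set X, nbhs x W &
  forall s, seq_in W s ->
  prism (slice t) (slice t') (coboundary q) s = 0.
have /compact_near_coveringP cov := X_compact.
suff : \forall t' \near t, [set: X] `<=` small t'.
  by apply: filterS => t' sm x; exact: sm.
apply: (cov T (nbhs t) small) => x _.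
have [V xV Vq] := q_cocycle (H (x, t)).
have [[/= A B] [xA tB] AB] := H_continuous xV.
exists (A°, B); first by split => //; exact: nbhs_interior.
move=> [y t'] /= [Ay Bt']; exists A; first exact: Ay.
move=> s As; apply: (prism_eq0 (V := V)) => //.
  apply: sub_seq_in As => z Az; apply: (AB (z, t)).
  by split=> //; exact: nbhs_singleton.
by apply: sub_seq_in As => z Az; apply: (AB (z, t')); split.
Qed.

(** The times at which the slice is cohomologous to the slice at [t0] form an
open and closed set, so all of [T]. At [t0] itself the pullback is computed on
constant sequences, and is the coboundary of the cone with vertex [c]. *)
Lemma cocycle_nullhomotopic (c : X) (t0 t1 : T) :
    (forall x, H (x, t0) = c) ->
  exists z, locally (fun s => q (map (fun x => H (x, t1)) s) = coboundary z s).
Proof.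
move=> H0.
suff [z lz] : cohomologous (slice t0) (slice t1).
  have [V cV Vq] := q_cocycle c.
  (* On constant sequences, [coboundary q (c :: s) = 0] says that [q s] is the
     coboundary of [q (c :: _)] at [s]. *)
  exists (fun s => z s + q (c :: map (fun=> c) s)).
  apply: sub_locally lz => s; rewrite (_ : slice t0 = fun=> c); last exact/funext.
  move=> e; rewrite coboundaryD -e.
  suff -> : coboundary (fun t => q (c :: map (fun=> c) t)) s
      = q (map (fun=> c) s) by rewrite subrK.
  rewrite -(coboundary_map _ (fun t => q (c :: t))).
  apply/eqP; rewrite eq_sym -subr_eq0; apply/eqP/(Vq (c :: map (fun=> c) s)).
  have Vc := nbhs_singleton cV.
  by apply/seq_in_cons; split=> // _ /mapP[y _ ->].
pose B t := cohomologous (slice t0) (slice t).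
suff BT : B = [set: T] by rewrite -/(B t1) BT.
apply: T_connected.
- exists t0; exists (fun=> 0); apply: locallyW => s.
  by rewrite coboundary0 subrr.
- exists B; last by rewrite setTI.
  rewrite openE => t Bt; apply: filterS (cohomologous_near t) => t'.
  exact: cohomologous_trans.
- exists B; last by rewrite setTI.
  rewrite -[B]setCK; apply: open_closedC; rewrite openE => t nBt.
  apply: filterS (cohomologous_near t) => t' tt' Bt'; apply: nBt.
  exact: cohomologous_trans Bt' (cohomologous_sym tt').
Qed.

End homotopy.
End locality.

Section finite_subcover.
Variable X : topologicalType.

(** The near-covering form of compactness is applied to the filter generated by
the sets of all finite sequences that contain a given one. *)
Lemma compact_finite_subcover (V : X -> set X) :
    compact [set: X] -> (forall x, nbhs x (V x)) ->
  exists xs : seq X, forall y, exists2 x, x \in xs & V x y.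
Proof.
move=> /compact_near_coveringP cov nV.
pose F : set_system (seq X) :=
  [set A | exists s : seq X, forall t : seq X, {subset s <= t} -> A t].
have FF : Filter F.
  split.
  - by exists [::].
  - move=> A B [s sA] [t tB]; exists (s ++ t) => u stu; split.
      by apply: sA => x xs; apply: stu; rewrite mem_cat xs.
    by apply: tB => x xt; apply: stu; rewrite mem_cat xt orbT.
  - by move=> A B AB [s sA]; exists s => t /sA /AB.
have [xs xsP] : F (fun s : seq X => [set: X] `<=`
    (fun y => exists2 x, x \in s & V x y)).
  apply: (cov _ F (fun s y => exists2 x, x \in s & V x y) FF) => x _.
  exists (V x, [set s : seq X | x \in s]).
    split; first exact: nV.
    by exists [:: x] => t; apply; rewrite inE.
  by move=> [y s] [/= Vy xs]; exists x.
by exists xs => y; exact: xsP.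
Qed.

End finite_subcover.

(** * Cochains on a space with an action of Z/k *)

Section Zp_primitive.
Variable k : nat.

(** A function of sum zero on a cyclic group is a difference: its partial sums
close up when the index wraps around. *)
Lemma Zp_sum_primitive (F : 'Z_k -> int) (l : 'Z_k) :
    \sum_i F i = 0 ->
  \sum_(i : 'Z_k | (i < (l + 1)%R)%N) F i -
    \sum_(i : 'Z_k | (i < l)%N) F i = F l.
Proof.
move=> F0.
have splitl : \sum_(i : 'Z_k | (i <= l)%N) F i =
    F l + \sum_(i : 'Z_k | (i < l)%N) F i.
  rewrite (bigD1 l)//=; congr (_ + _); apply: eq_bigl => i.
  by rewrite ltn_neqAle andbC.
have [lk|lk] := ltnP l.+1 (Zp_trunc k).+2.
  have -> : ((l + 1)%R : nat) = l.+1.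
    rewrite /= /Zp_add /= (modn_small (m := 1))// addn1 modn_small//.
  under eq_bigl => i do rewrite ltnS.
  by rewrite splitl addrK.
have lmax : (l : nat) = (Zp_trunc k).+1.
  by apply/eqP; rewrite eqn_leq -ltnS ltn_ord -ltnS lk.
have -> : ((l + 1)%R : nat) = 0%N.
  by rewrite /= (modn_small (m := 1))// addn1 lmax modnn.
rewrite big_pred0// sub0r; apply/eqP; rewrite eqr_oppLR -addr_eq0 addrC.
rewrite -splitl -[X in _ == X]F0; apply/eqP; apply: eq_bigl => i.
by rewrite lmax -ltnS ltn_ord.
Qed.

End Zp_primitive.

Section zk_cochains.
Variables (k : nat) (X : topologicalType) (a : zk_action k X).
Implicit Types (q : seq X -> int) (s : seq X) (g : 'Z_k).

(** The two operators of the periodic resolution of Z over the group ring of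
Z/k. *)
Definition norm_cochain q s := \sum_g q (map (a g) s).
Definition diff_cochain q s := q (map (a 1) s) - q s.

Lemma map_actD g h s : map (a g) (map (a h) s) = map (a (g + h)) s.
Proof. by rewrite -map_comp; apply: eq_map => x /=; rewrite actD. Qed.

Lemma map_act0 s : map (a 0) s = s.
Proof. by rewrite -[RHS]map_id; apply: eq_map => x; rewrite act0. Qed.

Lemma norm_cochain_act q g s : norm_cochain q (map (a g) s) = norm_cochain q s.
Proof.
rewrite /norm_cochain [RHS](reindex_inj (addIr g)) /=.
by apply: eq_bigr => h _; rewrite map_actD.
Qed.

Lemma norm_diff q s : norm_cochain (diff_cochain q) s = 0.
Proof.
rewrite /norm_cochain /diff_cochain sumrB; apply/eqP; rewrite subr_eq0.
rewrite [X in _ == X](reindex_inj (addrI 1)) /=; apply/eqP/eq_bigr => g _.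
by rewrite map_actD.
Qed.

Lemma coboundary_norm q s :
  coboundary (norm_cochain q) s = norm_cochain (coboundary q) s.
Proof.
rewrite coboundary_sum; apply: eq_bigr => g _.
by rewrite coboundary_map.
Qed.

Lemma coboundary_diff q s :
  coboundary (diff_cochain q) s = diff_cochain (coboundary q) s.
Proof. by rewrite /diff_cochain coboundaryB coboundary_map. Qed.

Lemma diff0_invariant q :
  (forall s, diff_cochain q s = 0) -> forall g s, q (map (a g) s) = q s.
Proof.
move=> q0 g s; rewrite -[g]natr_Zp; elim: (g : nat) s => [|n IHn] s.
  by rewrite map_act0.
rewrite mulrS addrC -map_actD IHn; apply/eqP; rewrite -subr_eq0.
exact/eqP/q0.
Qed.

(** A labelling of each free orbit by the group, which amounts to choosing a
point in the orbit; in the orbits that meet [W] it is their point in [W]. *)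
Lemma exists_label (x0 : X) (W : set X) :
    free_action a -> (forall g x, W x -> W (a g x) -> g = 0) ->
  exists l : X -> 'Z_k,
    (forall g x, l (a g x) = l x + g) /\ (forall x, W x -> l x = 0).
Proof.
move=> a_free W_disj.
pose orbit x := [set y | exists g, y = a g x].
have orbit_act g x : orbit (a g x) = orbit x.
  apply/seteqP; split=> y [h ->]; first by exists (h + g); rewrite actD.
  by exists (h - g); rewrite -actD subrK.
pose rep x := xget (xget x0 (orbit x)) (orbit x `&` W).
have repP x : exists g, x = a g (rep x).
  suff [g e] : orbit x (rep x) by exists (- g); rewrite e -actD addNr act0.
  rewrite /rep; case: xgetP => [y _ []//|_].
  by case: xgetP => [y _ //|/(_ x)[]]; exists 0; rewrite act0.
have [l lP] := choice repP; exists l; split=> [g x|x Wx].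
  have rep_act : rep (a g x) = rep x by rewrite /rep orbit_act.
  have := lP (a g x); rewrite rep_act [in LHS](lP x) -actD => e.
  apply/eqP; rewrite -subr_eq0; apply/eqP/(a_free _ (rep x)).
  by rewrite addrC actD -e -actD (addrC g) addNr act0.
have rep_x : rep x = x.
  rewrite /rep; case: xgetP => [_ -> [[h ->] Wh]|/(_ x)[]].
    by rewrite (W_disj _ _ Wx Wh) act0.
  by split=> //; exists 0; rewrite act0.
by apply: (a_free _ x); rewrite -{2}rep_x -lP.
Qed.

(** Exactness of the periodic resolution at the kernel of the norm. The value of
the primitive at [s] only involves the translates of [s], so it is as local as
[q], up to the action. *)
Lemma exists_diff_primitive (l : X -> 'Z_k) q :
    (forall g x, l (a g x) = l x + g) ->
    (forall s, norm_cochain q s = 0) ->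
  exists z, (forall s, diff_cochain z s = q s) /\
    forall s, (forall g, q (map (a g) s) = 0) -> z s = 0.
Proof.
move=> lD q0.
exists (fun s => if s is y :: _ then
  \sum_(i : 'Z_k | (i < l y)%N) q (map (a (i - l y)) s) else 0).
split=> [[|y s]|[|y s] qs0//]; last by rewrite big1.
  rewrite /diff_cochain /= subr0; apply/esym/eqP.
  have /eqP := q0 [::]; rewrite /norm_cochain /= sumr_const.
  by rewrite mulrn_eq0 card_ord.
rewrite /diff_cochain /=.
pose F i := q (map (a (i - l y)) (y :: s)).
have F0 : \sum_i F i = 0.
  rewrite -[RHS](q0 (y :: s)) /norm_cochain [LHS](reindex_inj (addIr (l y))) /=.
  by apply: eq_bigr => i _; rewrite /F addrK.
have := Zp_sum_primitive (l y) F0; rewrite {3}/F subrr map_act0 => <-.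
congr (_ - _); rewrite lD; apply: eq_bigr => i _.
rewrite -[_ :: _]/(map (a _) (map (a 1) (y :: s))) map_actD /F.
by rewrite opprD addrA subrK.
Qed.

(** * Null-homotopic equivariant self-maps *)

Section no_nullhomotopic_equivariant_map.
Hypothesis a_free : free_action a.
Variable psi : X -> X.
Hypothesis psi_equivariant : equivariant a a psi.
Hypothesis psi_null : forall q, locally (fun s => coboundary q s = 0) ->
  exists z, locally (fun s => q (map psi s) = coboundary z s).
Variable x0 : X.
Variable V : X -> set X.
Hypotheses (V_open : forall y, open (V y))
  (V_disj : forall y g x, V y x -> V y (a g x) -> g = 0).

Let psi_act n g s :
  map (iter n psi) (map (a g) s) = map (a g) (map (iter n psi) s).
Proof.
rewrite -!map_comp; apply: eq_map => x /=.
by elim: n => //= n ->; exact: psi_equivariant.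
Qed.

Let psi_map g s : map psi (map (a g) s) = map (a g) (map psi s).
Proof. exact: psi_act 1 g s. Qed.

Let map_iterSr n s : map (iter n psi) (map psi s) = map (iter n.+1 psi) s.
Proof. by rewrite -map_comp; apply: eq_map => x; rewrite [RHS]iterSr. Qed.

Let locally_act P : locally P -> forall g, locally (fun s => P (map (a g) s)).
Proof. by move=> lP g; apply: locally_map lP; exact: act_continuous. Qed.

(** The nilpotence argument, by induction on the number of open sets whose
orbits are still needed to cover the places where [q] is not locally zero. Each
step replaces [q] by its product with the class of degree 2 of the covering, in
a form that vanishes on one more orbit. *)
Lemma transfer_of_locally_trivial (ys : seq X) q :
    (forall s, diff_cochain q s = 0) -> (forall s, coboundary q s = 0) ->
    (forall x, (exists2 U : set X, nbhs x U & forall s, seq_in U s -> q s = 0) \/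
      exists2 y, y \in ys & exists g, V y (a g x)) ->
  exists n z, locally (fun s =>
    q (map (iter n psi) s) = coboundary (norm_cochain z) s).
Proof.
elim: ys q => [|y ys IHys] q q_diff q_cocycle q_triv.
  exists 0%N, (fun=> 0) => x.
  have [[U xU q0]|[] //] := q_triv x.
  exists U => // s Us; rewrite map_id q0// coboundary_norm.
  by rewrite /norm_cochain big1// => g _; rewrite coboundary0.
have q_inv := diff0_invariant q_diff.
have q_nil : q [::] = 0 by have := q_cocycle [:: x0]; rewrite /= subr0.
(* u is q on the sequences that start at a point of label 0, hence N u = q. *)
have [l [lD lV]] := exists_label x0 a_free (@V_disj y).
pose u s := if s is z :: _ then (if l z == 0 then q s else 0) else 0.
have u_act h t : u (map (a h) t) =
    if t is z :: _ then (if l z + h == 0 then q t else 0) else 0.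
  by case: t => //= z t; rewrite lD -(q_inv h (z :: t)).
have norm_u : norm_cochain u = q.
  apply/funext => -[|z s]; first by rewrite /norm_cochain big1.
  rewrite /norm_cochain (bigD1 (- l z)) //= lD subrr eqxx.
  rewrite -[_ :: _]/(map (a _) (z :: s)) q_inv big1 ?addr0// => g gl.
  by rewrite lD addrC addr_eq0 (negbTE gl).
have norm_du s : norm_cochain (coboundary u) s = 0.
  by rewrite -coboundary_norm norm_u q_cocycle.
(* As D v = delta u, the cocycle delta v represents the next class. *)
have [v [diff_v v0]] := exists_diff_primitive lD norm_du.
have := IHys (coboundary v).
case.
- by move=> s; rewrite -coboundary_diff (funext diff_v) coboundary_coboundary.
- exact: coboundary_coboundary.
- move=> x.
  suff du0 : (exists2 U : set X, nbhs x U &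
      forall s, seq_in U s -> forall h, coboundary u (map (a h) s) = 0) \/
      (exists2 y, y \in ys & exists g, V y (a g x)).
    case: du0 => [[U xU du0]|]; [left|by right].
    exists U => // s Us; rewrite -(coboundary0 s).
    by apply: coboundary_eq_in Us => t Ut; apply: v0 => h; exact: du0.
  (* Near x, either q vanishes, or the label is constant on each translate of a
     small sequence, so that there u is 0 or q; either way delta u = 0. *)
  have [[U xU q0]|[y']] := q_triv x.
    left; exists U => // s Us h; rewrite coboundary_map -(coboundary0 s).
    apply: coboundary_eq_in Us => t Ut; rewrite u_act.
    by case: t Ut => // z t Ut; rewrite q0// if_same.
  rewrite inE => /predU1P[->{y'}|y'ys] yx; last by right; exists y'.
  have [g Vgx] := yx; left; exists (a g @^-1` V y).
    by apply: act_continuous; exact: open_nbhs_nbhs.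
  move=> s Us h; rewrite coboundary_map.
  rewrite (_ : coboundary _ s = coboundary (fun t => if h == g then q t else 0) s).
    by case: eqP => _; [exact: q_cocycle|exact: coboundary0].
  apply: coboundary_eq_in Us => t Ut; rewrite u_act.
  case: t Ut => [_|z t /seq_in_cons[/lV + _]]; first by rewrite q_nil if_same.
  by rewrite lD => /eqP; rewrite addr_eq0 => /eqP ->; rewrite addrC subr_eq0.
move=> n [w lw].
(* The two pullbacks by psi undo the two connecting maps in turn. *)
have [|z1 lz1] := @psi_null (fun s => v (map (iter n psi) s) - norm_cochain w s).
  apply: sub_locally lw => s e; rewrite coboundaryB -e -coboundary_map.
  by rewrite subrr.
have [|z2 lz2] := @psi_null
    (fun s => u (map (iter n.+1 psi) s) - diff_cochain z1 s).
  apply: sub_locally (locallyI lz1 (locally_act lz1 1)) => s [e e1].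
  rewrite coboundaryB -coboundary_map coboundary_diff -diff_v /diff_cochain.
  rewrite -e -e1 psi_map psi_act norm_cochain_act map_iterSr.
  ring.
exists n.+2, z2.
apply: sub_locally (locally_forall (locally_act lz2)) => s e.
rewrite coboundary_norm -norm_u /norm_cochain.
under [RHS]eq_bigr => g _ do rewrite -e psi_map psi_act map_iterSr.
rewrite sumrB -[X in _ - X]/(norm_cochain (diff_cochain z1) (map psi s)).
by rewrite norm_diff subr0.
Qed.

End no_nullhomotopic_equivariant_map.

(** A free action of a finite group on a Hausdorff space is properly
discontinuous. *)
Lemma free_disjoint_open (y : X) : hausdorff_space X -> free_action a ->
  exists V : set X, [/\ open V, V y & forall g x, V x -> V (a g x) -> g = 0].
Proof.
rewrite open_hausdorff => X_hausdorff a_free.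
have /choice[B BP] : forall g, exists B : set X * set X, g != 0 ->
    [/\ open B.1, open B.2, B.1 y, B.2 (a g y) & B.1 `&` B.2 = set0].
  move=> g; have [->|g0] := eqVneq g 0; first by exists (set0, set0).
  have : y != a g y by apply: contra_neq g0 => /esym/a_free.
  move=> /X_hausdorff[B [/set_mem B1y /set_mem B2y] [B1 B2 /eqP B0]].
  by exists B.
pose W := [set x | forall g, g != 0 -> (B g).1 x /\ (B g).2 (a g x)].
have Wy : nbhs y W.
  apply: filter_forall => g.
  have [->|g0] := eqVneq g 0; first by apply: filterE.
  have [B1 B2 B1y B2y _] := BP g g0.
  apply: filterS2 (open_nbhs_nbhs (conj B1 B1y)) _ => [x B1x B2x _|].
    by split; [exact: B1x|exact: B2x].
  by apply: act_continuous; exact: open_nbhs_nbhs.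
exists W°; split=> [||g x /interior_subset Wx /interior_subset Wgx].
- exact: open_interior.
- exact: Wy.
apply/eqP/negPn/negP => g0; have [_ _ _ _ B0] := BP g g0.
have [[_ B2] [B1 _]] := (Wx g g0, Wgx g g0).
by have : ((B g).1 `&` (B g).2) (a g x) by []; rewrite B0.
Qed.

(** A Borsuk-Ulam theorem for free actions of Z/k on compact Hausdorff spaces.
For the sphere with the antipodal action it says that an odd self-map is not
null-homotopic. *)
Theorem equivariant_not_nullhomotopic (T : topologicalType) (H : X * T -> X)
    (c : X) (t0 t1 : T) :
    compact [set: X] -> hausdorff_space X -> free_action a ->
    connected [set: T] -> continuous H ->
    (forall x, H (x, t0) = c) ->
  ~ (forall g x, H (a g x, t1) = a g (H (x, t1))).
Proof.
move=> X_compact X_hausdorff a_free T_connected H_continuous H0 psi_equiv.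
pose psi x := H (x, t1).
have psi_null q : locally (fun s => coboundary q s = 0) ->
    exists z, locally (fun s => q (map psi s) = coboundary z s).
  move=> q_cocycle.
  exact: (cocycle_nullhomotopic X_compact T_connected H_continuous q_cocycle).
have /choice[V VP] := fun y => free_disjoint_open y X_hausdorff a_free.
have V_nbhs y : nbhs y (V y).
  by have [Vo Vy _] := VP y; exact: open_nbhs_nbhs.
have [ys ysP] := compact_finite_subcover X_compact V_nbhs.
(* The coboundary of u is the constant 1 in degree 0. *)
pose u s : int := (s == [::] :> seq X)%:R.
have [] := @transfer_of_locally_trivial a_free psi psi_equiv
  psi_null c V _ _ ys (coboundary u).
- by move=> y; have [] := VP y.
- by move=> y; have [] := VP y.
- move=> s; rewrite -coboundary_diff.
  rewrite (_ : diff_cochain u = fun=> 0) ?coboundary0//.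
  by apply/funext => -[|y t]; rewrite /diff_cochain /u /= subrr.
- exact: coboundary_coboundary.
- move=> x; right; have [y yys Vyx] := ysP x.
  by exists y => //; exists 0; rewrite act0.
move=> n [z lz]; have [U cU Uz] := lz c.
have := Uz [:: c]; rewrite /= /norm_cochain /= sumr_const card_ord !subr0.
have -> : u [::] = 1 by [].
move=> e; have : ((Zp_trunc k).+2 %| 1)%Z.
  (* In degree -1 the norm is multiplication by the order of the group. *)
  apply/dvdzP; exists (z [::]).
  rewrite -(mulr_natr (z [::])) natz in e; apply: e.
  by move=> y; rewrite inE => /eqP ->; exact: nbhs_singleton.
by rewrite dvdz1.
Qed.

End zk_cochains.

(** * Continuous functions on a compact Hausdorff space *)

Section modulus.
Variables (R : realType).
Local Notation normc := (@Normc.normc R).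
Implicit Types z w : R[i].

Lemma normc_ge0 z : 0 <= normc z.
Proof. by case: z => x y; rewrite sqrtr_ge0. Qed.

Lemma normc_sum (I : finType) (F : I -> R[i]) :
  normc (\sum_i F i) <= \sum_i normc (F i).
Proof.
elim/big_ind2: _ => // [|z1 r1 z2 r2 le1 le2]; first by rewrite Normc.normc0.
exact: le_trans (le_normcD _ _) (lerD le1 le2).
Qed.

Lemma normc_real (x : R) : normc x%:C%C = `|x|.
Proof. by rewrite /= expr0n addr0 sqrtr_sqr. Qed.

End modulus.

Section Cfun_theory.
Variables (R : realType) (X : topologicalType).
Local Notation normc := (@Normc.normc R).
Implicit Types f g : Cfun R X.

Lemma Cfun_continuous f : continuous (Cfun_val f).
Proof. exact: cts_fun. Qed.

Lemma CfunD f g x : Cfun_val (f + g) x = f x + g x. Proof. by []. Qed.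
Lemma CfunN f x : Cfun_val (- f) x = - f x. Proof. by []. Qed.
Lemma CfunM f g x : Cfun_val (f * g) x = f x * g x. Proof. by []. Qed.
Lemma CfunZ (c : R[i]) f x : Cfun_val (c *: f) x = c * f x. Proof. by []. Qed.
Lemma Cfun1 x : Cfun_val (1 : Cfun R X) x = 1. Proof. by []. Qed.

Lemma CmkE (f : X -> R[i]) (cf : continuous f) x : Cfun_val (Cmk cf) x = f x.
Proof. by []. Qed.

Lemma Cfun_sum I (r : seq I) (F : I -> Cfun R X) x :
  Cfun_val (\sum_(i <- r) F i) x = \sum_(i <- r) F i x.
Proof. by apply: (big_morph (fun f : Cfun R X => Cfun_val f x)). Qed.

Lemma Cfun_near f x (e : R) :
  0 < e -> \forall y \near x, normc (f y - f x) < e.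
Proof.
move=> e0; have /(@cvgrPdist_lt R[i] R[i])/(_ e%:C%C) :=
  Cfun_continuous (f := f) (x := x).
rewrite ltcR => /(_ e0); apply: filterS => y.
by rewrite distrC ltcR.
Qed.

Lemma Cfun_near_neq0 f x : f x != 0 -> \forall y \near x, f y != 0.
Proof.
move=> fx0; have e0 : 0 < normc (f x).
  rewrite lt_neqAle normc_ge0 andbT eq_sym.
  by apply: contra_neq fx0; exact: Normc.eq0_normc.
apply: filterS (Cfun_near f x e0) => y; apply: contraTneq => ->.
by rewrite sub0r normcN ltxx.
Qed.

Lemma Cfun_bounded f :
  compact [set: X] -> exists M : R, forall x, normc (f x) <= M.
Proof.
move=> X_compact.
have [xs xsP] := compact_finite_subcover X_compact
  (fun x => Cfun_near f x (ltr01 : (0 : R) < 1)).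
exists (\sum_(x <- xs) (normc (f x) + 1)) => y.
have [x xxs yx] := xsP y.
have : 0 <= \sum_(z <- rem x xs) (normc (f z) + 1).
  by apply: sumr_ge0 => z _; rewrite addr_ge0// normc_ge0.
have := le_normcD (f y - f x) (f x); rewrite subrK (big_rem x xxs) /=.
move: yx; set u := normc _; set v := normc _; set w := normc _; lra.
Qed.

Lemma exists_inverse f : (forall x, f x != 0) -> exists g, f * g = 1.
Proof.
move=> f0.
have cg : continuous (fun x => (f x)^-1).
  by move=> x; apply: (@continuousV R[i]) => //; exact: Cfun_continuous.
by exists (Cmk cg); apply: CfunP => x; rewrite CfunM mulfV.
Qed.

(** Gelfand duality for C(X). Otherwise each point has a nearby nonvanishing
function killed by [chi]; the sum of the squared moduli of finitely many of
these is invertible and killed by [chi]. *)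
Lemma character_is_evaluation (chi : Cfun R X -> R[i]) :
    compact [set: X] ->
    (forall f g, chi (f + g) = chi f + chi g) ->
    (forall c f, chi (c *: f) = c * chi f) ->
    (forall f g, chi (f * g) = chi f * chi g) -> chi 1 = 1 ->
  exists x, forall f, chi f = f x.
Proof.
move=> X_compact chiD chiZ chiM chi1; apply: contrapT => noX.
have /choice[F FP] : forall x, exists f, chi f != f x.
  move=> x; apply: contrapT => /forallNP nf; apply: noX; exists x => f.
  exact/eqP/negPn/negP/nf.
pose b x : Cfun R X := F x - chi (F x) *: (1 : Cfun R X).
have chib x : chi (b x) = 0.
  by rewrite /b -scaleNr chiD chiZ chi1 mulr1 subrr.
have bx x : Cfun_val (b x) x != 0.
  by rewrite /b CfunD CfunN CfunZ Cfun1 mulr1 subr_eq0 eq_sym FP.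
have [xs xsP] := compact_finite_subcover X_compact
  (fun x => Cfun_near_neq0 (bx x)).
pose B := \sum_(x <- xs) Cfun_star (b x) * b x.
have B0 y : Cfun_val B y != 0.
  rewrite Cfun_sum psumr_eq0/=; last by move=> x _; rewrite CfunM mulrC -sqr_normc.
  have [x xxs bxy] := xsP y.
  apply/allPn; exists x => //; rewrite CfunM mulf_neq0//.
  by rewrite conjc_eq0.
have [g Bg] := exists_inverse B0.
have chiB : chi B = 0.
  rewrite /B; apply: (big_ind (fun f => chi f = 0)).
  - by rewrite -(scale0r (1 : Cfun R X)) chiZ mul0r.
  - by move=> f h f0 h0; rewrite chiD f0 h0 addr0.
  - by move=> x _; rewrite chiM chib mulr0.
by have /eqP := chi1; rewrite -Bg chiM chiB mul0r eq_sym oner_eq0.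
Qed.

(** The topology of [X] is determined by its continuous functions; the
continuity of maps into [X] and the equality of points of [X] are tested through
this. *)
Lemma urysohn_Cfun x (U : set X) : compact [set: X] -> hausdorff_space X ->
    nbhs x U -> exists f, f x = 0 /\ forall y, normc (f y) < 1 -> U y.
Proof.
move=> X_compact X_hausdorff xU.
have /(@normal_separatorP R) sep := compact_normal X_hausdorff X_compact.
have x_closed : closed [set x].
  exact/accessible_closed_set1/hausdorff_accessible.
have : [set x] `&` ~` U° = set0.
  apply/seteqP; split=> y //= [->]; apply.
  exact: nbhs_singleton (nbhs_interior xU).
have oU : closed (~` U°) by apply: open_closedC; exact: open_interior.
move=> /(sep _ _ x_closed oU)/(@uniform_separatorP _ R)[f [cf _ f0 f1]].
have cg : continuous (fun y => (f y)%:C%C).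
  move=> y; apply/(@cvgrPdist_lt R[i] R[i]) => e e0.
  have e_real : e = (complex.Re e)%:C%C by rewrite RRe_real// gtr0_real.
  have e0' : 0 < complex.Re e by rewrite -ltcR -e_real.
  have /cvgrPdist_lt/(_ _ e0') := cf y; apply: filterS => z yz.
  rewrite e_real -rmorphB /= ltcR normc_real.
  exact: yz.
exists (Cmk cg); split=> [|y].
  by rewrite CmkE (f0 (f x))//; exists x.
rewrite CmkE normc_real => fy; apply: interior_subset.
apply: contrapT => Uy.
have f1y : f y = 1 by apply: f1; exists y.
by move: fy; rewrite f1y normr1 ltxx.
Qed.

Lemma Cfun_separates x y : compact [set: X] -> hausdorff_space X ->
  (forall f, f x = f y) -> x = y.
Proof.
move=> X_compact X_hausdorff fxy; apply: (X_hausdorff) => A B xA yB.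
have [f [fx0 fA]] := urysohn_Cfun X_compact X_hausdorff xA.
exists y; split; last exact: nbhs_singleton.
by apply: fA; rewrite -fxy fx0 Normc.normc0.
Qed.

End Cfun_theory.

(** * Characters of the crossed product at fixed points *)

Section coeff_sum.
Variables (R : realType) (k : nat) (X : topologicalType) (b : zk_action k X).
Local Notation normc := (@Normc.normc R).
Local Notation order := (#|'Z_k|%:R : R).
Implicit Types (u v : crossed R b) (x : X) (xi : 'Z_k -> R[i]).

(** At a point fixed by [b] this is the character of the crossed product that
evaluates at the point and sends the unitary mu to 1. *)
Definition coeff_sum u x : R[i] := \sum_j Cfun_val (u j) x.

Lemma coeff_sumD u v x : coeff_sum (u + v) x = coeff_sum u x + coeff_sum v x.
Proof. by rewrite -big_split; apply: eq_bigr => j _; rewrite ffunE. Qed.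

Lemma coeff_sumN u x : coeff_sum (- u) x = - coeff_sum u x.
Proof. by rewrite -sumrN; apply: eq_bigr => j _; rewrite ffunE. Qed.

Lemma coeff_sumZ c u x : coeff_sum (c *: u) x = c * coeff_sum u x.
Proof. by rewrite mulr_sumr; apply: eq_bigr => j _; rewrite ffunE. Qed.

Lemma coeff_sum1 x : coeff_sum 1 x = 1.
Proof.
rewrite /coeff_sum (bigD1 0)//= ffunE eqxx big1 ?addr0// => j j0.
by rewrite ffunE (negbTE j0).
Qed.

Lemma coeff_sumM u v x : Fix b x ->
  coeff_sum (u * v) x = coeff_sum u x * coeff_sum v x.
Proof.
move=> bx; rewrite /coeff_sum mulr_suml.
under eq_bigr => m _ do rewrite ffunE Cfun_sum.
rewrite exchange_big; apply: eq_bigr => j _.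
(* The twist by [b] in the product is invisible at a fixed point. *)
rewrite mulr_sumr (reindex_inj (addIr j)) /=; apply: eq_bigr => m _.
by rewrite CfunM addrK CmkE bx.
Qed.

Lemma coeff_sum_near u x (e : R) : 0 < e ->
  \forall y \near x, normc (coeff_sum u y - coeff_sum u x) < e.
Proof.
move=> e0; apply: filterS (Cfun_near (\sum_j u j) x e0) => y.
by rewrite !Cfun_sum.
Qed.

Let order_gt0 : 0 < order.
Proof. by rewrite ltr0n card_ord. Qed.

Lemma normc_le_l2norm xi i : normc (xi i) <= l2norm xi.
Proof.
rewrite -[leLHS]ger0_norm ?normc_ge0// -sqrtr_sqr; apply: ler_wsqrtr.
by rewrite (bigD1 i)//= lerDl sumr_ge0// => j _; rewrite sqr_ge0.
Qed.

Lemma l2norm_le xi (C : R) : (forall i, normc (xi i) <= C) ->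
  l2norm xi <= Num.sqrt (order * C ^+ 2).
Proof.
move=> xiC; apply: ler_wsqrtr.
rewrite mulr_natl -sumr_const; apply: ler_sum => i _.
by rewrite lerXn2r// nnegrE ?normc_ge0// (le_trans _ (xiC i))// normc_ge0.
Qed.

(** The supremum defining the norm is over a bounded set, so it does bound the
elements of the set. *)
Lemma regular_rep_bounded u : compact [set: X] ->
  has_ubound [set l2norm (regular_rep x u xi) |
    x in [set: X] & xi in [set xi : 'Z_k -> R[i] | l2norm xi <= 1]].
Proof.
move=> X_compact.
have /choice[M MP] := fun j => Cfun_bounded (u j) X_compact.
exists (Num.sqrt (order * (\sum_j M j) ^+ 2)) => _ [x _ [xi xi1 <-]].
apply: l2norm_le => i; apply: le_trans (normc_sum _) _.
apply: ler_sum => j _; rewrite Normc.normcM -[leRHS]mulr1.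
apply: ler_pM; rewrite ?normc_ge0//; first exact: MP.
exact: le_trans (normc_le_l2norm _ _) xi1.
Qed.

(** The regular representation at [x] is tested on the constant vector of value
1 / order, whose image has the sum of the coefficients, over the order, as its
0-th entry. The constant is not optimal, but suffices for continuity. *)
Lemma normc_coeff_sum u x : compact [set: X] ->
  normc (coeff_sum u x) <= order * crossed_norm u.
Proof.
move=> X_compact.
have inv_ge0 : 0 <= order^-1 by rewrite invr_ge0 ltW.
pose xi (_ : 'Z_k) : R[i] := (order^-1)%:C%C.
have xi1 : l2norm xi <= 1.
  rewrite -[leRHS]sqrtr1; apply: le_trans (l2norm_le (C := order^-1) _) _.
    by move=> i; rewrite normc_real ger0_norm.
  apply: ler_wsqrtr; rewrite expr2 mulrA mulfV ?gt_eqF// mul1r.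
  by rewrite invf_le1// ler1n card_ord.
rewrite -ler_pdivrMl//.
apply: le_trans (ub_le_sup (regular_rep_bounded u X_compact) _); last first.
  by exists x => //; exists xi.
apply: le_trans (normc_le_l2norm _ 0).
rewrite /regular_rep -mulr_suml Normc.normcM normc_real ger0_norm// [leRHS]mulrC.
rewrite le_eqVlt; apply/orP; left; apply/eqP.
congr (_ * normc _); apply: eq_bigr => j _.
by rewrite CmkE oppr0 act0.
Qed.

End coeff_sum.

(** * The homotopy defined by an equivariant homomorphism *)

Section clip.
Variable R : realType.

Lemma clip_subproof (t : R) : Num.max 0 (Num.min t 1) \in @unit_itv R.
Proof.
apply/mem_set; rewrite /unit_itv /= le_max lexx.
by rewrite ge_max ler01 ge_min lexx orbT.
Qed.

(** A retraction onto the unit interval, so that homotopies can be parametrized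
by the connected space [R] instead of a subtype of it. *)
Definition clip (t : R) : @unit_itv R := SigSub (clip_subproof t).

Lemma clipE t : set_val (clip t) = Num.max 0 (Num.min t 1) :> R.
Proof. by []. Qed.

Lemma clip0 : set_val (clip 0) = 0 :> R.
Proof. by rewrite clipE min_l// maxxx. Qed.

Lemma clip1 : set_val (clip 1) = 1 :> R.
Proof. by rewrite clipE minxx max_r. Qed.

Lemma clip_continuous : continuous clip.
Proof.
apply: continuous_comp_initial => t.
apply: (@continuous_max R R (fun=> 0) (fun t => Num.min t 1)).
  exact: cst_continuous.
apply: (@continuous_min R R id (fun=> 1)); first exact: cvg_id.
exact: cst_continuous.
Qed.

Lemma real_connected : connected [set: R].
Proof. by apply/connected_intervalP. Qed.

End clip.

Section induced_homotopy.
Variables (R : realType) (k : nat) (X : topologicalType).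
Variables a b : zk_action k X.
Hypotheses (X_compact : compact [set: X]) (X_hausdorff : hausdorff_space X).
Variable phi : Cfun R X -> twisted_join R b.
Hypotheses (phi_hom : is_unital_star_hom phi)
  (phi_equivariant : tilde_equivariant a phi).
Variable r : X -> X.
Hypotheses (r_continuous : continuous r) (r_Fix : forall x, Fix b (r x))
  (r_equivariant : equivariant a a r).
Local Notation normc := (@Normc.normc R).

Let ev (xt : X * R) (g : Cfun R X) : R[i] :=
  coeff_sum (set_val (phi g) (clip xt.2)) (r xt.1).

Let evE x t g : ev (x, t) g = coeff_sum (set_val (phi g) (clip t)) (r x).
Proof. by []. Qed.

Let ev_point xt : exists y, forall g, ev xt g = g y.
Proof.
have [phiD phiZ phiM phi1 _] := phi_hom.
apply: character_is_evaluation => // [f g|c f|f g|].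
- by rewrite /ev phiD coeff_sumD.
- by rewrite /ev phiZ coeff_sumZ.
- by rewrite /ev phiM coeff_sumM.
- by rewrite /ev phi1 coeff_sum1.
Qed.

(* Move the time first, at the new point, which costs at most the norm of the
   difference in the crossed product; then move the point at the old time. *)
Let ev_near xt g (e : R) :
  0 < e -> \forall yu \near xt, normc (ev yu g - ev xt g) < e.
Proof.
move=> e0; case: xt => x t.
have e2 : 0 < e / 2 by rewrite divr_gt0.
pose order : R := #|'Z_k|%:R.
have order_gt0 : 0 < order by rewrite ltr0n card_ord.
pose h := set_val (phi g).
have h_continuous : Defs.norm_continuous h by have /set_mem[] := valP (phi g).
have near_x : \forall y \near x,
    normc (coeff_sum (h (clip t)) (r y) - coeff_sum (h (clip t)) (r x)) < e / 2.
  exact: r_continuous (coeff_sum_near (h (clip t)) (r x) e2).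
have near_t : \forall u \near t,
    order * crossed_norm (h (clip u) - h (clip t)) < e / 2.
  suff : \forall s \near clip t, order * crossed_norm (h s - h (clip t)) < e / 2.
    by move=> near_s; exact: (clip_continuous near_s).
  have e' : 0 < e / 2 / order by rewrite !divr_gt0.
  have /cvgrPdist_lt/(_ _ e') := h_continuous (clip t).
  apply: filterS => s; rewrite sub0r normrN => sle.
  by rewrite mulrC -ltr_pdivlMr//; exact: le_lt_trans (ler_norm _) sle.
exists ([set y | normc (coeff_sum (h (clip t)) (r y) -
    coeff_sum (h (clip t)) (r x)) < e / 2],
  [set u | order * crossed_norm (h (clip u) - h (clip t)) < e / 2]) => //.
move=> [y u] /= [xy tu].
have := normc_coeff_sum (h (clip u) - h (clip t)) (r y) X_compact.
rewrite coeff_sumD coeff_sumN -/order => yu.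
have := le_normcD (coeff_sum (h (clip u)) (r y) - coeff_sum (h (clip t)) (r y))
  (coeff_sum (h (clip t)) (r y) - coeff_sum (h (clip t)) (r x)).
rewrite addrA subrK /ev /= -/h.
move: xy tu yu; set A := normc _; set B := crossed_norm _.
set D := normc _; set E := normc _; lra.
Qed.

Let H xt : X := projT1 (cid (ev_point xt)).

Let HE xt g : Cfun_val g (H xt) = ev xt g.
Proof. by rewrite /H; case: cid. Qed.

Let H_continuous : continuous H.
Proof.
move=> xt U HU.
have [g [g0 gU]] := urysohn_Cfun R X_compact X_hausdorff HU.
apply: filterS (ev_near xt g ltr01) => yu.
by rewrite -!HE g0 subr0 => /gU.
Qed.

Let H0 x y : H (x, 0) = H (y, 0).
Proof.
apply: (Cfun_separates (R := R) X_compact X_hausdorff) => g.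
have [c gc] : crossed_group (set_val (phi g) (clip 0)).
  by have /set_mem[_ group0 _] := valP (phi g); apply: group0; exact: clip0.
rewrite !HE !evE gc.
by apply: eq_bigr => j _; rewrite !ffunE.
Qed.

Let act_natr (c : zk_action k X) n x : c n%:R x = iter n (c 1) x.
Proof.
by elim: n => [|n IHn]; [rewrite act0|rewrite mulrS actD IHn].
Qed.

Let H1_act1 x : H (a 1 x, 1) = a 1 (H (x, 1)).
Proof.
apply: (Cfun_separates (R := R) X_compact X_hausdorff) => g.
rewrite -[RHS]/(Cfun_val (Cact a 1 g) (H (x, 1))) !HE !evE.
have [g1 gg1] : crossed_base (set_val (phi g) (clip 1)).
  by have /set_mem[_ _ base1] := valP (phi g); apply: base1; exact: clip1.
rewrite phi_equivariant r_equivariant /tilde_act /= gg1.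
apply: eq_bigr => j _; rewrite !ffunE.
(* Only j = 0 contributes, where the root of unity omega does not appear. *)
case: eqP => [->|_]; first by rewrite expr0 scale1r CmkE.
by rewrite Cact_is0 scaler0.
Qed.

(** [G (x, t)] is the point at which the character at the fixed point [r x],
composed with [phi] at time [t], evaluates. *)
Lemma equivariant_nullhomotopy_of_star_hom :
  X -> exists (G : X * R -> X) (c : X),
  [/\ continuous G, forall x, G (x, 0) = c &
      forall g x, G (a g x, 1) = a g (G (x, 1))].
Proof.
move=> x0; exists H, (H (x0, 0)); split=> // g x.
rewrite -[g]natr_Zp !act_natr; elim: (g : nat) => //= n IHn.
by rewrite H1_act1 IHn.
Qed.

End induced_homotopy.

Unset Implicit Arguments.

Theorem proposition2p4 (R : realType) (k : nat) (X : topologicalType)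
    (alpha beta : zk_action k X)
    (k_prime : prime k)
    (X_compact : compact [set: X]) (X_hausdorff : hausdorff_space X)
    (alpha_beta : commuting alpha beta)
    (alpha_free : free_action alpha) (beta_nonfree : ~ free_action beta)
    (f : X -> Fix beta) (f_continuous : continuous f)
    (f_equivariant :
       equivariant alpha (restrict_action (Fix_stable alpha_beta)) f) :
  ~ exists phi : Cfun R X -> twisted_join R beta,
      is_unital_star_hom phi /\ tilde_equivariant alpha phi.
Proof.
move=> [phi [phi_hom phi_equivariant]].
apply: beta_nonfree => g x _; exfalso.
pose r x : X := set_val (f x).
have r_continuous : continuous r.
  move=> y; apply: (@continuous_comp _ _ _ f set_val); first exact: f_continuous.
  exact: initial_continuous.
have r_Fix y : Fix beta (r y) by apply: set_mem; exact: valP.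
have r_equivariant : equivariant alpha alpha r.
  by move=> h y; rewrite /r f_equivariant.
have [G [c [G_continuous G0 G1]]] := equivariant_nullhomotopy_of_star_hom
  X_compact X_hausdorff phi_hom phi_equivariant r_continuous r_Fix
  r_equivariant x.
exact: (equivariant_not_nullhomotopic X_compact X_hausdorff alpha_free
  (@real_connected R) G_continuous G0 G1).
Qed.
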